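(* Let $\mathbb{K}$ be a field of characteristic zero, let $n\ge 2$ and $m\ge 1$ be integers, and let $SL^{n,m}$ be the Lie superalgebra over $\mathbb{K}$ defined in the context (the maximal-dimensional solvable Lie superalgebra whose nilradical is the model filiform Lie superalgebra $L^{n,m}$). Then $SL^{n,m}$ is (cohomologically) rigid, i.e. its second adjoint cohomology vanishes: $$\dim \mathrm{H}^2(SL^{n,m};SL^{n,m})=\dim \mathrm{H}^2_{\bar 0}(SL^{n,m};SL^{n,m})+\dim \mathrm{H}^2_{\bar 1}(SL^{n,m};SL^{n,m})=0.$$
   Context: The Lie superalgebra $SL^{n,m}$. Its even part has basis $X_1,\dots,X_n,T_1,T_2,T_3$ and its odd part has basis $Y_1,\dots,Y_m$. The only non-zero brackets of basis elements (up to the super skew-symmetry $[X,Y]=-(-1)^{|X||Y|}[Y,X]$) are - $[X_1,X_i]=X_{i+1}$ for $2\le i\le n-1$; $[X_1,Y_j]=Y_{j+1}$ for $1\le j\le m-1$; - $[T_1,X_i]=iX_i$ for $1\le i\le n$; $[T_1,Y_j]=jY_j$ for $1\le j\le m$; - $[T_2,X_i]=X_i$ for $2\le i\le n$; $[T_3,Y_j]=Y_j$ for $1\le j\le m$. In particular the bracket of any two odd elements is zero. The span of $X_1,\dots,X_n,Y_1,\dots,Y_m$ is the model filiform Lie superalgebra $L^{n,m}$. Cohomology. For a Lie superalgebra $\mathfrak g=\mathfrak g_{\bar 0}\oplus\mathfrak g_{\bar 1}$ and a $\mathfrak g$-module $A=A_{\bar 0}\oplus A_{\bar 1}$, the $q$-cochains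 are $C^q(\mathfrak g;A)=\bigoplus_{q_0+q_1=q}\mathrm{Hom}(\wedge^{q_0}\mathfrak g_{\bar 0}\otimes S^{q_1}\mathfrak g_{\bar 1},A)$, graded by $C^q=C^q_{\bar 0}\oplus C^q_{\bar 1}$, where $C^q_p$ is the sum of the $\mathrm{Hom}(\wedge^{q_0}\mathfrak g_{\bar 0}\otimes S^{q_1}\mathfrak g_{\bar 1},A_r)$ with $q_0+q_1=q$ and $q_1+r\equiv p \bmod 2$. The differential is $$\begin{aligned}(dc)(g_1,\dots,g_{q_0},h_1,\dots,h_{q_1})={}&\sum_{1\le s<t\le q_0}(-1)^{s+t-1}c([g_s,g_t],g_1,\dots,\hat g_s,\dots,\hat g_t,\dots,g_{q_0},h_1,\dots,h_{q_1})\\&+\sum_{s=1}^{q_0}\sum_{t=1}^{q_1}(-1)^{s-1}c(g_1,\dots,\hat g_s,\dots,g_{q_0},[g_s,h_t],h_1,\dots,\hat h_t,\dots,h_{q_1})\\&+\sum_{1\le s<t\le q_1}c([h_s,h_t],g_1,\dots,g_{q_0},h_1,\dots,\hat h_s,\dots,\hat h_t,\dots,h_{q_1})\\&+\sum_{s=1}^{q_0}(-1)^s g_s\cdot c(g_1,\dots,\hat g_s,\dots,g_{q_0},h_1,\dots,h_{q_1})\\&+(-1)^{q_0-1}\sum_{s=1}^{q_1}h_s\cdot c(g_1,\dots,g_{q_0},h_1,\dots,\hat h_s,\dots,h_{q_1})\end{aligned}$$ for $g_i\in\mathfrak g_{\bar 0}$, $h_j\in\mathfrak g_{\bar 1}$.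 It satisfies $d\circ d=0$ and preserves the parity $p$. With $Z^q_p$ the cocycles and $B^q_p$ the coboundaries of parity $p$, $\mathrm{H}^q_p(\mathfrak g;A)=Z^q_p/B^q_p$ and $\mathrm{H}^q=\mathrm{H}^q_{\bar 0}\oplus \mathrm{H}^q_{\bar 1}$. $\mathrm{H}^q(\mathfrak g;\mathfrak g)$ denotes cohomology with coefficients in the adjoint module. *)

(* Defs.v *)
From HB Require Import structures.
From mathcomp Require Import all_boot all_order all_algebra.
From mathcomp Require Import functions ring.

Set Implicit Arguments.
Unset Strict Implicit.
Unset Printing Implicit Defensive.

Import GRing.Theory.
Local Open Scope ring_scope.

(* A super vector space V_0 + V_1 is represented by the product V0 * V1;
   parities are booleans, true being the odd one. *)
Section Superspace.
Variables (K : fieldType) (V0 V1 : lmodType K).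

Definition ev (x : V0) : V0 * V1 := (x, 0).
Definition od (y : V1) : V0 * V1 := (0, y).

Definition homogeneous (p : bool) (x : V0 * V1) : Prop :=
  if p then x.1 = 0 else x.2 = 0.

End Superspace.

Arguments ev {K V0 V1}.
Arguments od {K V0 V1}.

Definition graded_bilinear (K : fieldType) (V0 V1 W0 W1 : lmodType K)
    (f : V0 * V1 -> W0 * W1 -> W0 * W1) : Prop :=
  [/\ forall x, linear (f x), forall y, linear (f^~ y)
    & forall p r x y, homogeneous p x -> homogeneous r y ->
        homogeneous (p (+) r) (f x y)].

Record lieSuperalgebra (K : fieldType) := LieSuperalgebra {
  lie0 : lmodType K;
  lie1 : lmodType K;
  lbr : lie0 * lie1 -> lie0 * lie1 -> lie0 * lie1;
  lbr_bilinear : graded_bilinear lbr;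
  lbr_skew : forall p r x y, homogeneous p x -> homogeneous r y ->
    lbr x y = - ((-1) ^+ (p && r) *: lbr y x);
  lbr_jacobi : forall p r x y z, homogeneous p x -> homogeneous r y ->
    lbr x (lbr y z) = lbr (lbr x y) z + (-1) ^+ (p && r) *: lbr y (lbr x z)
}.

Record lieSupermodule (K : fieldType) (L : lieSuperalgebra K) :=
    LieSupermodule {
  mod0 : lmodType K;
  mod1 : lmodType K;
  act : lie0 L * lie1 L -> mod0 * mod1 -> mod0 * mod1;
  act_bilinear : graded_bilinear act;
  act_lbr : forall p r x y a, homogeneous p x -> homogeneous r y ->
    act (lbr x y) a =
    act x (act y a) - (-1) ^+ (p && r) *: act y (act x a)
}.

Lemma adjoint_act_lbr (K : fieldType) (L : lieSuperalgebra K) p r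
    (x y z : lie0 L * lie1 L) : homogeneous p x -> homogeneous r y ->
  lbr (lbr x y) z = lbr x (lbr y z) - (-1) ^+ (p && r) *: lbr y (lbr x z).
Proof. by move=> hx hy; rewrite (lbr_jacobi z hx hy) addrK. Qed.

Definition adjoint (K : fieldType) (L : lieSuperalgebra K) :
    lieSupermodule L :=
  LieSupermodule (lbr_bilinear L) (@adjoint_act_lbr K L).

(* [quotient_dim Z B d] : the subspace Z has dimension d modulo B, i.e. some
   d vectors of Z are mapped to a basis of Z / B. *)
Definition quotient_dim (K : fieldType) (U : lmodType K)
    (Z B : U -> Prop) (d : nat) : Prop :=
  exists v : 'I_d -> U, (forall i, Z (v i)) /\
    forall z, Z z ->
      exists! a : 'rV[K]_d, B (z - \sum_(i < d) a 0 i *: v i).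

Section Cohomology.
Variables (K : fieldType) (L : lieSuperalgebra K) (A : lieSupermodule L).

Local Notation g0 := (lie0 L).
Local Notation g1 := (lie1 L).
Local Notation cochain := (seq g0 -> seq g1 -> mod0 A * mod1 A).

(* An element of C^q is a family, indexed by q0 + q1 = q, of maps of q0 even
   and q1 odd arguments, alternating multilinear in the former and symmetric
   multilinear in the latter.  Such a family is encoded as a single function
   of two lists of arguments, the numbers q0 and q1 being their lengths, which
   vanishes when the total number of arguments is not q. *)
Definition is_cochain (q : nat) (c : cochain) : Prop :=
  [/\ forall gs gs' hs, linear (fun x => c (gs ++ x :: gs') hs),
      forall gs hs hs', linear (fun y => c gs (hs ++ y :: hs')),
      forall gs gs' gs'' x hs, c (gs ++ x :: gs' ++ x :: gs'') hs = 0,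
      forall gs hs hs', perm_eq hs hs' -> c gs hs = c gs hs'
    & forall gs hs, (size gs + size hs)%N <> q -> c gs hs = 0].

Definition cochain_parity (p : bool) (c : cochain) : Prop :=
  forall gs hs, homogeneous (odd (size hs) (+) p) (c gs hs).

Definition del (T : Type) (i : nat) (s : seq T) : seq T :=
  take i s ++ drop i.+1 s.

Definition lbr00 (x y : g0) : g0 := (lbr (ev x) (ev y)).1.
Definition lbr01 (x : g0) (y : g1) : g1 := (lbr (ev x) (od y)).2.
Definition lbr11 (x y : g1) : g0 := (lbr (od x) (od y)).1.

(* The arguments are numbered from 0, which shifts the exponents. *)
Definition differential (c : cochain) : cochain := fun gs hs =>
  let q0 := size gs in
  let q1 := size hs in
  \sum_(0 <= t < q0) \sum_(0 <= s < t) (-1) ^+ (s + t + 1) *: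
      c (lbr00 gs`_s gs`_t :: del s (del t gs)) hs
  + \sum_(0 <= s < q0) \sum_(0 <= t < q1) (-1) ^+ s *:
      c (del s gs) (lbr01 gs`_s hs`_t :: del t hs)
  + \sum_(0 <= t < q1) \sum_(0 <= s < t)
      c (lbr11 hs`_s hs`_t :: gs) (del s (del t hs))
  + \sum_(0 <= s < q0) (-1) ^+ s.+1 *: act (ev gs`_s) (c (del s gs) hs)
  + (-1) ^+ q0.+1 *: \sum_(0 <= s < q1) act (od hs`_s) (c gs (del s hs)).

Definition cocycle (q : nat) (p : bool) (c : cochain) : Prop :=
  [/\ is_cochain q c, cochain_parity p c & differential c = 0].

Definition coboundary (q : nat) (p : bool) (b : cochain) : Prop :=
  if q is q'.+1 then
    exists c, [/\ is_cochain q' c, cochain_parity p c & b = differential c]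
  else b = 0.

Definition cohomology_dim (q : nat) (p : bool) (d : nat) : Prop :=
  quotient_dim (cocycle q p) (coboundary q p) d.

End Cohomology.

Section SL.
Variables (K : fieldType) (n m : nat).

(* k-th unit vector and k-th coordinate, numbered from 1; both vanish when k
   is out of range. *)
Definition unit_row (d k : nat) : 'rV[K]_d := \row_(i < d) (i.+1 == k)%:R.
Definition coordr (d k : nat) (v : 'rV[K]_d) : K :=
  \sum_(i < d | i.+1 == k) v 0 i.

Definition SL0 : lmodType K := ('rV[K]_n * 'rV[K]_3)%type.
Definition SL1 : lmodType K := 'rV[K]_m.
Local Notation sl := (SL0 * SL1)%type.

Definition SLX (i : nat) : sl := ((unit_row n i, 0), 0).
Definition SLT (k : nat) : sl := ((0, unit_row 3 k), 0).
Definition SLY (j : nat) : sl := ((0, 0), unit_row m j).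

Definition coordX (i : nat) (x : sl) : K := coordr i x.1.1.
Definition coordT (k : nat) (x : sl) : K := coordr k x.1.2.
Definition coordY (j : nat) (x : sl) : K := coordr j x.2.

(* The bilinear map given on the basis SLX i, SLT k, SLY j by
     (X_1, X_i) |-> X_(i+1), 2 <= i <= n-1;  (X_1, Y_j) |-> Y_(j+1), j <= m-1;
     (T_1, X_i) |-> i X_i;                   (T_1, Y_j) |-> j Y_j;
     (T_2, X_i) |-> X_i, 2 <= i <= n;        (T_3, Y_j) |-> Y_j,
   and zero on all other pairs of basis elements. *)
Definition SL_half (x y : sl) : sl :=
  \sum_(2 <= i < n) (coordX 1 x * coordX i y) *: SLX i.+1
  + \sum_(1 <= j < m) (coordX 1 x * coordY j y) *: SLY j.+1
  + \sum_(1 <= i < n.+1) (coordT 1 x * coordX i y) *: (i%:R *: SLX i)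
  + \sum_(1 <= j < m.+1) (coordT 1 x * coordY j y) *: (j%:R *: SLY j)
  + \sum_(2 <= i < n.+1) (coordT 2 x * coordX i y) *: SLX i
  + \sum_(1 <= j < m.+1) (coordT 3 x * coordY j y) *: SLY j.

(* Two odd elements have a zero bracket, so that super skew-symmetry is
   ordinary skew-symmetry. *)
Definition SL_br (x y : sl) : sl := SL_half x y - SL_half y x.

Lemma coordr_linear d k : linear (coordr k : 'rV[K]_d -> K^o).
Proof.
move=> a u v; rewrite /coordr scaler_sumr -big_split /=.
by apply: eq_bigr => i _; rewrite !mxE.
Qed.

Lemma coordr_unit d k l :
  coordr k (unit_row d l) = ((l == k) && (0 < k <= d)%N)%:R.
Proof.
rewrite /coordr; have [/andP[k_gt0 le_kd]|kPn] := boolP (0 < k <= d)%N; last first.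
  rewrite andbF big1 // => i /eqP def_k.
  by rewrite -def_k ltn_ord in kPn.
have lt_kd : (k.-1 < d)%N by rewrite prednK.
rewrite andbT (big_pred1 (Ordinal lt_kd)) => [|i].
  by rewrite mxE /= prednK // eq_sym.
by rewrite -[in LHS](prednK k_gt0) eqSS.
Qed.

Lemma coordr_out d k (v : 'rV[K]_d) : ~~ (0 < k <= d)%N -> coordr k v = 0.
Proof.
move=> kPn; rewrite /coordr big1 // => i /eqP def_k.
by rewrite -def_k ltn_ord in kPn.
Qed.

Lemma coordr_inj d (u v : 'rV[K]_d) :
  (forall k, (0 < k <= d)%N -> coordr k u = coordr k v) -> u = v.
Proof.
move=> euv; apply/rowP => i.
have coordE (w : 'rV[K]_d) : coordr i.+1 w = w 0 i.
  by rewrite /coordr (big_pred1 i) // => j; rewrite eqSS.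
by rewrite -!coordE euv //= ltn_ord.
Qed.

Lemma coordX_linear k : linear (coordX k : sl -> K^o).
Proof. by move=> a x y; apply: coordr_linear. Qed.
Lemma coordT_linear k : linear (coordT k : sl -> K^o).
Proof. by move=> a x y; apply: coordr_linear. Qed.
Lemma coordY_linear k : linear (coordY k : sl -> K^o).
Proof. by move=> a x y; apply: coordr_linear. Qed.

HB.instance Definition _ k :=
  GRing.isLinear.Build K sl K^o _ (coordX k) (coordX_linear k).
HB.instance Definition _ k :=
  GRing.isLinear.Build K sl K^o _ (coordT k) (coordT_linear k).
HB.instance Definition _ k :=
  GRing.isLinear.Build K sl K^o _ (coordY k) (coordY_linear k).

Lemma coordXX k i : coordX k (SLX i) = ((i == k) && (0 < k <= n)%N)%:R.
Proof. exact: coordr_unit. Qed.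
Lemma coordXY k j : coordX k (SLY j) = 0.
Proof. by rewrite /coordX /coordr big1 // => i _; rewrite mxE. Qed.
Lemma coordTX k i : coordT k (SLX i) = 0.
Proof. by rewrite /coordT /coordr big1 // => l _; rewrite mxE. Qed.
Lemma coordTY k j : coordT k (SLY j) = 0.
Proof. by rewrite /coordT /coordr big1 // => l _; rewrite mxE. Qed.
Lemma coordYX k i : coordY k (SLX i) = 0.
Proof. by rewrite /coordY /coordr big1 // => l _; rewrite mxE. Qed.
Lemma coordYY k j : coordY k (SLY j) = ((j == k) && (0 < k <= m)%N)%:R.
Proof. exact: coordr_unit. Qed.

Lemma coord_inj (x y : sl) :
    (forall k, (0 < k <= n)%N -> coordX k x = coordX k y) ->
    (forall k, coordT k x = coordT k y) ->
    (forall k, (0 < k <= m)%N -> coordY k x = coordY k y) ->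
  x = y.
Proof.
case: x y => [[x1 x2] x3] [[y1 y2] y3] eX eT eY.
by congr (_, _, _); apply: coordr_inj => k kP; [apply: eX|apply: eT|apply: eY].
Qed.

Lemma sum_pick a b k (b0 : bool) (F : nat -> K) :
  \sum_(a <= i < b) F i * ((i == k) && b0)%:R
    = F k * ((a <= k < b) && b0)%N%:R.
Proof.
case: b0; last first.
  by rewrite andbF mulr0 big1 // => i _; rewrite andbF mulr0.
rewrite andbT; under eq_bigr => i _ do rewrite andbT.
have [kP|kPn] := boolP (a <= k < b)%N.
  rewrite (bigD1_seq k) ?mem_index_iota ?iota_uniq //= eqxx big1 ?addr0 //.
  by move=> i /negPf->; rewrite mulr0.
rewrite mulr0 big_nat big1 // => i iP.
case: eqP => [eik|_]; last exact: mulr0.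
by rewrite -eik iP in kPn.
Qed.

Lemma scale_regular (a b : K) : a *: (b : K^o) = a * b.
Proof. by []. Qed.

Lemma eq_succ_pred k i : (0 < k)%N -> (i.+1 == k) = (i == k.-1).
Proof. by case: k. Qed.

Lemma coordX_half k x y : (0 < k <= n)%N ->
  coordX k (SL_half x y) =
    (2 < k)%:R * (coordX 1 x * coordX k.-1 y)
    + k%:R * (coordT 1 x * coordX k y)
    + (1 < k)%:R * (coordT 2 x * coordX k y).
Proof.
move=> kP; have [k_gt0 le_kn] := andP kP.
rewrite /SL_half !linearD /= !linear_sum /=.
under eq_bigr => i _ do rewrite linearZ /= coordXX kP eq_succ_pred // scale_regular.
under [X in _ + X + _ + _ + _ + _]eq_bigr => i _ do
  rewrite linearZ /= coordXY scaler0.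
under [X in _ + X + _ + _ + _]eq_bigr => i _ do
  rewrite 2!linearZ /= coordXX kP !scale_regular mulrA.
under [X in _ + X + _ + _]eq_bigr => i _ do
  rewrite 2!linearZ /= coordXY !scaler0.
under [X in _ + X + _]eq_bigr => i _ do rewrite linearZ /= coordXX kP scale_regular.
under [X in _ + X]eq_bigr => i _ do rewrite linearZ /= coordXY scaler0.
rewrite !big1_eq !sum_pick !andbT !addr0 !ltnS k_gt0 le_kn !andbT mulr1.
have -> : (1 < k.-1 < n)%N = (2 < k)%N.
  by case: k k_gt0 {kP} le_kn => //= k _ ->; rewrite andbT.
by congr (_ + _ + _); rewrite mulrC.
Qed.

Lemma coordY_half k x y : (0 < k <= m)%N ->
  coordY k (SL_half x y) =
    (1 < k)%:R * (coordX 1 x * coordY k.-1 y)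
    + k%:R * (coordT 1 x * coordY k y)
    + coordT 3 x * coordY k y.
Proof.
move=> kP; have [k_gt0 le_km] := andP kP.
rewrite /SL_half !linearD /= !linear_sum /=.
under eq_bigr => i _ do rewrite linearZ /= coordYX scaler0.
under [X in _ + X + _ + _ + _ + _]eq_bigr => i _ do
  rewrite linearZ /= coordYY kP eq_succ_pred // scale_regular.
under [X in _ + X + _ + _ + _]eq_bigr => i _ do
  rewrite 2!linearZ /= coordYX !scaler0.
under [X in _ + X + _ + _]eq_bigr => i _ do
  rewrite 2!linearZ /= coordYY kP !scale_regular mulrA.
under [X in _ + X + _]eq_bigr => i _ do rewrite linearZ /= coordYX scaler0.
under [X in _ + X]eq_bigr => i _ do rewrite linearZ /= coordYY kP scale_regular.
rewrite !big1_eq !sum_pick !andbT !addr0 !add0r !ltnS k_gt0 le_km !mulr1.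
have -> : (0 < k.-1 < m)%N = (1 < k)%N.
  by case: k k_gt0 {kP} le_km => //= k _ ->; rewrite andbT.
by congr (_ + _ + _); rewrite mulrC.
Qed.

Lemma coordT_half k x y : coordT k (SL_half x y) = 0.
Proof.
rewrite /SL_half !linearD /= !linear_sum /=.
by rewrite !big1 ?addr0 // => i _; rewrite !linearZ /= ?coordTX ?coordTY !scaler0.
Qed.

Lemma coordX_br k x y : (0 < k <= n)%N ->
  coordX k (SL_br x y) =
    (2 < k)%:R * (coordX 1 x * coordX k.-1 y - coordX 1 y * coordX k.-1 x)
    + k%:R * (coordT 1 x * coordX k y - coordT 1 y * coordX k x)
    + (1 < k)%:R * (coordT 2 x * coordX k y - coordT 2 y * coordX k x).
Proof. by move=> kP; rewrite linearB /= !coordX_half //; ring. Qed.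

Lemma coordY_br k x y : (0 < k <= m)%N ->
  coordY k (SL_br x y) =
    (1 < k)%:R * (coordX 1 x * coordY k.-1 y - coordX 1 y * coordY k.-1 x)
    + k%:R * (coordT 1 x * coordY k y - coordT 1 y * coordY k x)
    + (coordT 3 x * coordY k y - coordT 3 y * coordY k x).
Proof. by move=> kP; rewrite linearB /= !coordY_half //; ring. Qed.

Lemma coordT_br k x y : coordT k (SL_br x y) = 0.
Proof. by rewrite linearB /= !coordT_half subrr. Qed.

Lemma coordX1_br x y :
  coordX 1 (SL_br x y) = coordT 1 x * coordX 1 y - coordT 1 y * coordX 1 x.
Proof.
have [n_gt0|n0] := boolP (0 < n)%N; first by rewrite coordX_br //= !mul0r mul1r add0r addr0.
by rewrite /coordX !coordr_out //; ring.
Qed.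

Lemma SL_br_linearr x : linear (SL_br x).
Proof.
move=> a y z; apply: coord_inj => k *; rewrite linearP /=.
- by rewrite !coordX_br // !linearP /= !scale_regular; ring.
- by rewrite !coordT_br scaler0 addr0.
- by rewrite !coordY_br // !linearP /= !scale_regular; ring.
Qed.

Lemma SL_brC x y : SL_br x y = - SL_br y x.
Proof. by rewrite opprB. Qed.

Lemma SL_br_linearl y : linear (SL_br^~ y).
Proof.
move=> a x z /=; rewrite ![SL_br _ y]SL_brC SL_br_linearr.
by rewrite opprD scalerN.
Qed.

Lemma SL_homogeneousP p (x : sl) :
  homogeneous p x <->
  if p then (forall k, coordX k x = 0) /\ (forall k, coordT k x = 0)
  else forall k, coordY k x = 0.
Proof.
have coordr0 d k : coordr k (0 : 'rV[K]_d) = 0.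
  by rewrite /coordr big1 // => i _; rewrite mxE.
case: x p => [[x1 x2] x3] []; split=> /=.
- by case=> -> ->; split=> k; apply: coordr0.
- by case=> e1 e2; congr (_, _); apply: coordr_inj => k _; rewrite coordr0;
    [apply: e1|apply: e2].
- by move=> -> k; apply: coordr0.
- by move=> e3; apply: coordr_inj => k _; rewrite coordr0; apply: e3.
Qed.

Lemma SL_br_odd x y : homogeneous true x -> homogeneous true y ->
  SL_br x y = 0.
Proof.
move=> /SL_homogeneousP[x0 x0'] /SL_homogeneousP[y0 y0'].
by apply: coord_inj => k *; rewrite linear0 ?coordX_br ?coordT_br ?coordY_br //
  ?x0 ?y0 ?x0' ?y0'; ring.
Qed.

Lemma SL_br_homogeneous p r x y : homogeneous p x -> homogeneous r y ->
  homogeneous (p (+) r) (SL_br x y).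
Proof.
have even_odd (u v : sl) : homogeneous false u -> homogeneous true v ->
    homogeneous true (SL_br u v).
  move=> /SL_homogeneousP u0 /SL_homogeneousP[v0 v0'].
  apply/SL_homogeneousP; split=> k; last exact: coordT_br.
  have [kP|kPn] := boolP (0 < k <= n)%N; last exact: coordr_out.
  by rewrite coordX_br // !v0 !v0'; ring.
case: p r => [] [] hx hy.
- by rewrite (SL_br_odd hx hy).
- rewrite SL_brC /homogeneous -[RHS]oppr0; congr (- _).
  exact: (even_odd y x).
- exact: even_odd.
- move: hx hy => /SL_homogeneousP x0 /SL_homogeneousP y0.
  apply/SL_homogeneousP=> k.
  have [kP|kPn] := boolP (0 < k <= m)%N; last exact: coordr_out.
  by rewrite coordY_br // !x0 !y0; ring.
Qed.

Lemma SL_br_bilinear : graded_bilinear SL_br.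
Proof.
by split; [apply: SL_br_linearr|apply: SL_br_linearl|apply: SL_br_homogeneous].
Qed.

Lemma SL_br_skew p r x y : homogeneous p x -> homogeneous r y ->
  SL_br x y = - ((-1) ^+ (p && r) *: SL_br y x).
Proof.
case: p r => [] [] hx hy; rewrite ?expr0 ?scale1r -?SL_brC //.
by rewrite !SL_br_odd // scaler0 oppr0.
Qed.

Lemma SL_br_jacobi0 x y z :
  SL_br x (SL_br y z) = SL_br (SL_br x y) z + SL_br y (SL_br x z).
Proof.
have addX k u v : coordX k (u + v) = coordX k u + coordX k v.
  exact: linearD.
have addY k u v : coordY k (u + v) = coordY k u + coordY k v.
  exact: linearD.
have addT k u v : coordT k (u + v) = coordT k u + coordT k v.
  exact: linearD.
move: coord_inj coordX_br coordY_br coordT_br coordX1_br addX addY addT.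
move: coordX coordY coordT SL_br => cX cY cT br inj brX brY brT brX1 aX aY aT.
apply: inj => [k kP|k|k kP]; last 1 first.
- rewrite aY !(brY k) // !brT !brX1.
  have [->|k_neq1] := eqVneq k 1%N; first by rewrite /=; ring.
  have k1P : (0 < k.-1 <= m)%N.
    by case/andP: kP; case: k k_neq1 => [|[|k]] //= _ _ /ltnW.
  case: k kP k1P {k_neq1} => [|k] //= kP k1P.
  rewrite !(brY k) //; move: (1 < k)%N => b.
  have [-> ->] : (1 < k.+1)%N /\ (k.+1%:R = k%:R + 1 :> K).
    by split; [rewrite ltnS; case/andP: k1P|rewrite natr1].
  by ring.
- rewrite aX !(brX k) // !brT !brX1.
  have [->|k_neq1] := eqVneq k 1%N; first by rewrite /=; ring.
  have [->|k_neq2] := eqVneq k 2; first by rewrite /=; ring.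
  have k1P : (1 < k.-1 <= n)%N.
    by case/andP: kP; case: k k_neq1 k_neq2 => [|[|[|k]]] //= _ _ _ /ltnW.
  case: k kP k1P {k_neq1 k_neq2} => [|k] //= kP /andP[k_gt1 le_kn].
  rewrite !(brX k) ?le_kn ?(ltnW k_gt1) //; move: (2 < k)%N => b.
  rewrite ltnS k_gt1 ltnS (ltnW k_gt1) -natr1 /=.
  by ring.
- by rewrite aT !brT addr0.
Qed.

Lemma SL_br_jacobi p r x y z : homogeneous p x -> homogeneous r y ->
  SL_br x (SL_br y z) =
  SL_br (SL_br x y) z + (-1) ^+ (p && r) *: SL_br y (SL_br x z).
Proof.
move=> hx hy; rewrite {1}SL_br_jacobi0; congr (_ + _).
case: p r hx hy => [] [] hx hy; rewrite ?expr0 ?scale1r //=.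
suff -> : SL_br y (SL_br x z) = 0 by rewrite scaler0.
have br0 u : SL_br u 0 = 0.
  by have := SL_br_linearr u (-1) 0 0; rewrite !scaleN1r !addNr.
have def_z : z = 1 *: (z.1, 0) + (0, z.2).
  by rewrite scale1r; case: (z) => z1 z2; congr (_, _); rewrite /= ?addr0 ?add0r.
rewrite def_z (SL_br_linearr x) (SL_br_linearr y) scale1r.
rewrite (@SL_br_odd x (0, _)) // br0 addr0.
by apply: SL_br_odd => //; apply: (@SL_br_homogeneous true false).
Qed.

Definition SL : lieSuperalgebra K :=
  LieSuperalgebra SL_br_bilinear SL_br_skew SL_br_jacobi.

End SL.

(* Main.v *)
From HB Require Import structures.
Require Import Defs.
From mathcomp Require Import all_boot all_order all_algebra.
From mathcomp Require Import boolp functions ring zify.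

(** Every 2-cocycle c is shown to be a coboundary, so both cohomology spaces
have dimension 0.  The torus spanned by the T_k acts diagonally on the basis
[X_i, T_k, Y_j], and contraction with a torus element t is a homotopy: writing
f_t = c(t, _), evaluating dc = 0 on (t, e_a, e_b) gives
    (w_a + w_b - w_k) c(e_a, e_b)_k = (d f_t)(e_a, e_b)_k,
where w_a is the eigenvalue of t on e_a (lemma [toral_equation]).

For a sufficiently generic t (the element [regular]) this disposes of all
components with w_a + w_b <> w_k at once: dividing the (a, k) entry of f_t by
w_a - w_k produces a linear map g with (d g)(e_a, e_b)_k = c(e_a, e_b)_k there,
because d commutes with the action of t (lemma [contract_D]).  Here
characteristic zero is used to keep the integer weights apart.

There remain the components with w_a + w_b = w_k, which are
    c(X_1, X_i) in X_(i+1),   c(X_1, Y_j) in Y_(j+1),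
    c(T_k, X_i) in X_i,       c(T_k, Y_j) in Y_j,       c(T_k, T_l) in T.
The first two are removed by a diagonal map X_i -> u_i X_i, Y_j -> v_j Y_j whose
eigenvalues are partial sums of the coefficients of c.  The homotopy formula for
t = T_k, now read on balanced components, has left-hand side 0: it says that
f_(T_k) is a diagonal derivation of the nilradical, hence the bracket with some
torus element s_k, so that T_k -> - s_k removes the next two.  It also says that
the bracket of c(T_k, T_l) with X_1, X_2 and Y_1 has no component along these
vectors, which forces c(T_k, T_l) to have none along the torus.  The sum of
these linear maps is [primitive c], whose differential is c (lemma
[pairing_primitive]). *)

Set Implicit Arguments.
Unset Strict Implicit.
Unset Printing Implicit Defensive.

Import GRing.Theory.
Local Open Scope ring_scope.

(** * The differential in low degrees *)

Lemma sum_upto3 (V : nmodType) (F : nat -> V) :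
  (\sum_(0 <= i < 0) F i = 0) * (\sum_(0 <= i < 1) F i = F 0)
  * (\sum_(0 <= i < 2) F i = F 0 + F 1)
  * (\sum_(0 <= i < 3) F i = F 0 + F 1 + F 2).
Proof. by rewrite /index_iota /= !big_cons !big_nil !addr0 !addrA. Qed.

Section LowDegree.
Variables (K : fieldType) (L : lieSuperalgebra K) (A : lieSupermodule L).
Implicit Types (c : seq (lie0 L) -> seq (lie1 L) -> mod0 A * mod1 A)
  (x y z : lie0 L) (g h : lie1 L).

Ltac expand_differential :=
  rewrite /differential /del /= !sum_upto3 /= ?sum_upto3 ?scaler0 ?add0r
    ?addr0 ?addn0 ?exprS ?expr0 ?mulr1 ?mulN1r ?opprK ?scaleN1r ?scale1r
    ?addr0 ?addrA.

Lemma differential_eee c x y z :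
  differential c [:: x; y; z] [::] =
    c [:: lbr00 x y; z] [::] - c [:: lbr00 x z; y] [::]
    + c [:: lbr00 y z; x] [::]
    - act (ev x) (c [:: y; z] [::]) + act (ev y) (c [:: x; z] [::])
    - act (ev z) (c [:: x; y] [::]).
Proof. by expand_differential. Qed.

Lemma differential_eeo c x y h :
  differential c [:: x; y] [:: h] =
    c [:: lbr00 x y] [:: h] + c [:: y] [:: lbr01 x h] - c [:: x] [:: lbr01 y h]
    - act (ev x) (c [:: y] [:: h]) + act (ev y) (c [:: x] [:: h])
    - act (od h) (c [:: x; y] [::]).
Proof. by expand_differential. Qed.

Lemma differential_eoo c x g h :
  differential c [:: x] [:: g; h] =
    c [::] [:: lbr01 x g; h] + c [::] [:: lbr01 x h; g]
    + c [:: lbr11 g h; x] [::]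
    - act (ev x) (c [::] [:: g; h]) + act (od g) (c [:: x] [:: h])
    + act (od h) (c [:: x] [:: g]).
Proof. by expand_differential. Qed.

Lemma differential_ee c x y :
  differential c [:: x; y] [::] =
    c [:: lbr00 x y] [::] - act (ev x) (c [:: y] [::])
    + act (ev y) (c [:: x] [::]).
Proof. by expand_differential. Qed.

Lemma differential_eo c x h :
  differential c [:: x] [:: h] =
    c [::] [:: lbr01 x h] - act (ev x) (c [::] [:: h])
    + act (od h) (c [:: x] [::]).
Proof. by expand_differential. Qed.

Lemma differential_oo c g h :
  differential c [::] [:: g; h] =
    c [:: lbr11 g h] [::] - act (od g) (c [::] [:: h])
    - act (od h) (c [::] [:: g]).
Proof. by expand_differential; rewrite opprD addrA. Qed.

Lemma size_del (T : Type) i (s : seq T) :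
  (i < size s)%N -> size (del i s) = (size s).-1.
Proof.
by move=> lt_is; rewrite /del size_cat size_takel ?(ltnW lt_is) // size_drop;
  lia.
Qed.

Lemma act0r (u : lie0 L * lie1 L) : act u (0 : mod0 A * mod1 A) = 0.
Proof.
have [lin _ _] := act_bilinear A.
by have := lin u (-1) 0 0; rewrite !scaleN1r !addNr.
Qed.

Lemma differential_off_degree q c gs hs :
    (forall gs hs, (size gs + size hs)%N <> q -> c gs hs = 0) ->
    (size gs + size hs)%N <> q.+1 ->
  differential c gs hs = 0.
Proof.
move=> c0 szP; rewrite /differential.
rewrite ![X in X + _ + _ + _ + _]big_nat [X in X + _ + _ + _ + _]big1.
  rewrite ![X in _ + X + _ + _ + _]big_nat [X in _ + X + _ + _ + _]big1.
    rewrite ![X in _ + X + _ + _]big_nat [X in _ + X + _ + _]big1.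
      rewrite ![X in _ + X + _]big_nat [X in _ + X + _]big1.
        rewrite ![X in _ + _ *: X]big_nat [X in _ + _ *: X]big1.
          by rewrite scaler0 !addr0.
        move=> s /andP[_ sP]; rewrite c0 ?act0r // size_del //; lia.
      by move=> s /andP[_ sP]; rewrite c0 ?act0r ?scaler0 // size_del //; lia.
    move=> t /andP[_ tP]; rewrite big_nat big1 // => s /andP[_ sP].
    by rewrite c0 // /= !size_del ?size_del; lia.
  move=> s /andP[_ sP]; rewrite big_nat big1 // => t /andP[_ tP].
  by rewrite c0 ?scaler0 // /= !size_del; lia.
move=> t /andP[_ tP]; rewrite big_nat big1 // => s /andP[_ sP].
by rewrite c0 ?scaler0 // /= !size_del ?size_del; lia.
Qed.

End LowDegree.

(** * Linear maps and the basis of SL *)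

Section Prelim.
Variables (K : fieldType).

Lemma linear_at0 (U V : lmodType K) (f : U -> V) : linear f -> f 0 = 0.
Proof. by move=> lin; have := lin (-1) 0 0; rewrite !scaleN1r !addNr. Qed.

Lemma linear_atD (U V : lmodType K) (f : U -> V) x y :
  linear f -> f (x + y) = f x + f y.
Proof. by move=> lin; have := lin 1 x y; rewrite !scale1r. Qed.

Lemma linear_atZ (U V : lmodType K) (f : U -> V) a x :
  linear f -> f (a *: x) = a *: f x.
Proof.
by move=> lin; have := lin a x 0; rewrite !addr0 linear_at0 // addr0.
Qed.

Lemma linear_at_sum (U V : lmodType K) (f : U -> V) (I : Type) (r : seq I)
    (F : I -> U) :
  linear f -> f (\sum_(i <- r) F i) = \sum_(i <- r) f (F i).
Proof.
move=> lin; elim: r => [|i r IHr]; first by rewrite !big_nil linear_at0.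
by rewrite !big_cons linear_atD // IHr.
Qed.

Lemma pchar0_natr_eq (x y : nat) : [pchar K] =i pred0 ->
  (x%:R == y%:R :> K) = (x == y).
Proof.
move=> char0; wlog le_xy : x y / (x <= y)%N.
  by move=> H; case/orP: (leq_total x y) => /H //; rewrite eq_sym => ->;
    rewrite eq_sym.
rewrite eq_sym -subr_eq0 -natrB //; move/pcharf0P: char0 => ->.
by rewrite subn_eq0; lia.
Qed.

End Prelim.

Section Basis.
Variables (K : fieldType) (n m : nat).
Local Notation sl := (SL0 K n * SL1 K m)%type.
Local Notation br := (@SL_br K n m).

Definition sl_index : finType := (('I_n + 'I_3) + 'I_m)%type.
Definition isodd (a : sl_index) : bool := if a is inr _ then true else false.

Definition basis (a : sl_index) : sl :=
  match a with
  | inl (inl i) => SLX K n m i.+1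
  | inl (inr k) => SLT K n m k.+1
  | inr j => SLY K n m j.+1
  end.

Definition sl_coef (a : sl_index) (x : sl) : K :=
  match a with
  | inl (inl i) => coordX i.+1 x
  | inl (inr k) => coordT k.+1 x
  | inr j => coordY j.+1 x
  end.

Lemma sl_coef_linear a : linear (sl_coef a : sl -> K^o).
Proof.
by case: a => [[i|k]|j]; [apply: coordX_linear|apply: coordT_linear|
  apply: coordY_linear].
Qed.

HB.instance Definition _ a :=
  GRing.isLinear.Build K sl K^o _ (sl_coef a) (sl_coef_linear a).

Lemma sl_coefD a x y : sl_coef a (x + y) = sl_coef a x + sl_coef a y.
Proof. exact: linearD. Qed.

Lemma sl_coefZ a c x : sl_coef a (c *: x) = c * sl_coef a x.
Proof. exact: linearZ. Qed.

Lemma sl_coefN a x : sl_coef a (- x) = - sl_coef a x.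
Proof. exact: linearN. Qed.

Lemma coordXT k i : coordX k (SLT K n m i) = 0.
Proof. by rewrite /coordX /coordr big1 // => l _; rewrite mxE. Qed.

Lemma coordYT k i : coordY k (SLT K n m i) = 0.
Proof. by rewrite /coordY /coordr big1 // => l _; rewrite mxE. Qed.

Lemma coordTT k i :
  coordT k (SLT K n m i) = ((i == k) && (0 < k <= 3)%N)%:R.
Proof. exact: coordr_unit. Qed.

Lemma sl_coef_basis a b : sl_coef a (basis b) = (b == a)%:R.
Proof.
case: a b => [[i|i]|i] [[j|j]|j] /=; rewrite ?coordXX ?coordXT ?coordXY
  ?coordTX ?coordTT ?coordTY ?coordYX ?coordYT ?coordYY ?ltn_ord ?andbT //.
Qed.

Lemma sl_coef_ext x y : (forall a, sl_coef a x = sl_coef a y) -> x = y.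
Proof.
move=> e_xy; apply: coord_inj => [k kP|k|k kP].
- have lt_k : (k.-1 < n)%N by lia.
  by have := e_xy (inl (inl (Ordinal lt_k))); rewrite /= prednK //; lia.
- have [kP'|kPn] := boolP (0 < k <= 3)%N; last by rewrite /coordT !coordr_out.
  have lt_k : (k.-1 < 3)%N by lia.
  by have := e_xy (inl (inr (Ordinal lt_k))); rewrite /= prednK //; lia.
- have lt_k : (k.-1 < m)%N by lia.
  by have := e_xy (inr (Ordinal lt_k)); rewrite /= prednK //; lia.
Qed.

Lemma sl_coef_sum (F : sl_index -> K) a :
  sl_coef a (\sum_b F b *: basis b) = F a.
Proof.
rewrite linear_sum (bigD1 a) //= big1 => [|b b_neq_a].
  by rewrite linearZ /= sl_coef_basis eqxx addr0 scale_regular mulr1.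
by rewrite linearZ /= sl_coef_basis (negPf b_neq_a) scaler0.
Qed.

Lemma basis_decomp x : x = \sum_a sl_coef a x *: basis a.
Proof. by apply: sl_coef_ext => a; rewrite sl_coef_sum. Qed.

Lemma linear_basis (V : lmodType K) (f : sl -> V) x :
  linear f -> f x = \sum_a sl_coef a x *: f (basis a).
Proof.
move=> lin; rewrite [in LHS](basis_decomp x) linear_at_sum //.
by apply: eq_bigr => a _; apply: linear_atZ.
Qed.

(** Agreement is only asked for the basis vectors that occur in x and y, so that
the parities of x and y can be taken into account. *)
Lemma bilinear_ext (V : lmodType K) (F G : sl -> sl -> V) x y :
    (forall u, linear (F u)) -> (forall u, linear (F^~ u)) ->
    (forall u, linear (G u)) -> (forall u, linear (G^~ u)) ->
    (forall a b, sl_coef a x != 0 -> sl_coef b y != 0 ->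
       F (basis a) (basis b) = G (basis a) (basis b)) ->
  F x y = G x y.
Proof.
move=> Fr Fl Gr Gl eFG.
rewrite (linear_basis x (Fl y)) (linear_basis x (Gl y)); apply: eq_bigr => a _.
have [->|a_neq0] := eqVneq (sl_coef a x) 0; first by rewrite !scale0r.
congr (_ *: _); rewrite (linear_basis y (Fr _)) (linear_basis y (Gr _)).
apply: eq_bigr => b _.
have [->|b_neq0] := eqVneq (sl_coef b y) 0; first by rewrite !scale0r.
by rewrite eFG.
Qed.

Lemma sl_coef_ev_odd a (x : SL0 K n) : isodd a -> sl_coef a (ev x : sl) = 0.
Proof.
by case: a => [//|j] _; rewrite /= /coordY /coordr big1 // => i _; rewrite mxE.
Qed.

Lemma sl_coef_od_even a (y : SL1 K m) : ~~ isodd a -> sl_coef a (od y : sl) = 0.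
Proof.
by case: a => [[i|i]|//] _; rewrite /= /coordX /coordT /coordr big1 // => l _;
  rewrite mxE.
Qed.

Lemma homogeneous_sl_coefP p (x : sl) :
  homogeneous p x <-> forall a, isodd a != p -> sl_coef a x = 0.
Proof.
split=> [|H].
  case: x p => [x0 x1] [] /= => [->|->] a aP.
    by apply: sl_coef_od_even; case: a aP => [].
  by apply: sl_coef_ev_odd; case: a aP => [].
case: x H => [x0 x1] H; case: p H => H.
  rewrite /homogeneous; apply: (congr1 fst (_ : (x0, x1) = (0, x1))).
  apply: sl_coef_ext => a; case: (boolP (isodd a)) => aP.
    by case: a aP => [].
  by rewrite H // ?sl_coef_od_even //; case: (isodd a) aP.
rewrite /homogeneous; apply: (congr1 snd (_ : (x0, x1) = (x0, 0))).
apply: sl_coef_ext => a; case: (boolP (isodd a)) => aP.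
  by rewrite H ?sl_coef_ev_odd //; case: (isodd a) aP.
by case: a aP => [[]|].
Qed.

(** The eigenvalue on the basis vector a of the torus element with coordinates
t. *)
Definition tweight (t : 'rV[K]_3) (a : sl_index) : K :=
  match a with
  | inl (inl i) => i.+1%:R * coordr 1 t + (0 < i)%:R * coordr 2 t
  | inl (inr _) => 0
  | inr j => j.+1%:R * coordr 1 t + coordr 3 t
  end.

Definition toral (t : 'rV[K]_3) : SL0 K n := (0, t).

Lemma coordX_toral k t : coordX k (ev (toral t) : sl) = 0.
Proof. by rewrite /coordX /coordr big1 // => l _; rewrite mxE. Qed.
Lemma coordT_toral k t : coordT k (ev (toral t) : sl) = coordr k t.
Proof. by []. Qed.
Lemma coordY_toral k t : coordY k (ev (toral t) : sl) = 0.
Proof. by rewrite /coordY /coordr big1 // => l _; rewrite mxE. Qed.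

Lemma sl_coef_toral_br t a x :
  sl_coef a (br (ev (toral t)) x) = tweight t a * sl_coef a x.
Proof.
case: a => [[i|k]|j] /=; last 1 first.
- rewrite coordY_br ?ltn_ord // !coordX_toral !coordT_toral !coordY_toral.
  by ring.
- rewrite coordX_br ?ltn_ord // !coordX_toral !coordT_toral ltnS.
  by ring.
- by rewrite coordT_br mul0r.
Qed.

Lemma toral_br_basis t a : br (ev (toral t)) (basis a) = tweight t a *: basis a.
Proof.
apply: sl_coef_ext => b; rewrite sl_coef_toral_br linearZ /= sl_coef_basis.
by rewrite scale_regular; case: eqP => [->|_] //; rewrite !mulr0.
Qed.

(** The bracket respects weights because t acts by a derivation: the structure
constant vanishes unless the weights of a and b add up to that of k. *)
Lemma br_tweight t a b k :
  (tweight t k - tweight t a - tweight t b)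
    * sl_coef k (br (basis a) (basis b)) = 0.
Proof.
have := SL_br_jacobi0 (ev (toral t)) (basis a) (basis b).
move/(congr1 (sl_coef k)); rewrite sl_coef_toral_br !toral_br_basis.
rewrite (linear_atZ _ _ (SL_br_linearl _)) (linear_atZ _ _ (SL_br_linearr _)).
rewrite [RHS]linearD /= !linearZ /= !scale_regular => e.
by rewrite !mulrBl e; ring.
Qed.

(** The differential of the 1-cochain f, with s = 1 on (even, even) and (even,
odd) arguments and s = -1 on two odd ones, in which it is symmetric. *)
Definition twisted_derivation (s : K) (f : sl -> sl) (x y : sl) : sl :=
  f (br x y) - br x (f y) + s *: br y (f x).

Local Notation D := twisted_derivation.

Lemma sl_coef_D s f a b k : linear f ->
  sl_coef k (D s f (basis a) (basis b)) =
  \sum_l (sl_coef l (br (basis a) (basis b)) * sl_coef k (f (basis l))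
    - sl_coef l (f (basis b)) * sl_coef k (br (basis a) (basis l))
    + s * (sl_coef l (f (basis a)) * sl_coef k (br (basis b) (basis l)))).
Proof.
move=> lin; rewrite big_split sumrB /D linearD linearB linearZ /=.
rewrite (linear_basis (br _ _) lin) (linear_basis (f (basis b)) (SL_br_linearr
  _)).
rewrite (linear_basis (f (basis a)) (SL_br_linearr _)) !linear_sum /=.
by congr (_ - _ + _); apply: eq_bigr => l _; rewrite linearZ.
Qed.

Definition of_matrix (B : sl_index -> sl_index -> K) (x : sl) : sl :=
  \sum_k (\sum_a sl_coef a x * B a k) *: basis k.

Lemma of_matrix_linear B : linear (of_matrix B).
Proof.
move=> c x y; apply: sl_coef_ext => k; rewrite linearP /= !sl_coef_sum.
rewrite scale_regular mulr_sumr -big_split; apply: eq_bigr => a _ /=.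
by rewrite linearP /= scale_regular; ring.
Qed.

Lemma sl_coef_of_matrix B a k : sl_coef k (of_matrix B (basis a)) = B a k.
Proof.
rewrite sl_coef_sum (bigD1 a) //= sl_coef_basis eqxx mul1r big1 ?addr0 // => b
  bP.
by rewrite sl_coef_basis eq_sym (negPf bP) mul0r.
Qed.

(** Dividing the entries of f by the weight differences divides each component
of its differential by the weight of that component: the structure constants of
the bracket only connect weights that add up, so in every term of [sl_coef_D]
the entry of f has the same weight difference w_a + w_b - w_k. *)
Lemma contract_D s t f B a b k : linear f ->
    tweight t a + tweight t b != tweight t k ->
    (forall i l, tweight t i != tweight t l ->
       B i l = (tweight t i - tweight t l)^-1 * sl_coef l (f (basis i))) ->
  sl_coef k (D s (of_matrix B) (basis a) (basis b)) =
  (tweight t a + tweight t b - tweight t k)^-1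
    * sl_coef k (D s f (basis a) (basis b)).
Proof.
move=> lin w_neq BE; rewrite (sl_coef_D _ _ _ _ (of_matrix_linear B))
  (sl_coef_D _ _ _ _ lin).
rewrite mulr_sumr; apply: eq_bigr => l _; rewrite !sl_coef_of_matrix.
set w := tweight t in w_neq BE *; set z := (_ - _)^-1.
pose struct i j h := sl_coef h (br (basis i) (basis j)).
have weight i j h (r : K) : (w i + w j = w h -> r = 0) -> struct i j h * r = 0.
  move=> rP; have /eqP := br_tweight t i j h; rewrite mulf_eq0 -/w.
  case/orP=> /eqP h0; last by rewrite /struct h0 mul0r.
  by rewrite rP ?mulr0 //; apply/eqP; rewrite eq_sym -subr_eq0 opprD addrA h0.
rewrite -!/(struct _ _ _).
move: struct (sl_coef k (f (basis l))) (sl_coef l (f (basis a)))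
  (sl_coef l (f (basis b))) weight (BE l k) (BE b l) (BE a l).
move=> struct flk fal fbl weight BElk BEbl BEal.
have e1 : struct a b l * (B l k - z * flk) = 0.
  by apply: weight => e; rewrite BElk -e ?subrr.
have e2 : struct a l k * (B b l - z * fbl) = 0.
  apply: weight => e; rewrite BEbl /z -?e 1?[w a + _]addrC ?addrKA ?subrr //.
  by apply: contra w_neq; rewrite -e => /eqP->.
have e3 : struct b l k * (B a l - z * fal) = 0.
  have [eal|neal] := eqVneq (w a) (w l).
    by apply: weight => e; rewrite -e eal addrC eqxx in w_neq.
  by apply: weight => e; rewrite BEal // /z -e addrKA subrr.
move: e1 e2 e3; rewrite !mulrBr => /eqP; rewrite subr_eq0 => /eqP-> /eqP.
rewrite subr_eq0 ![_ * B _ _]mulrC => /eqP-> /eqP.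
by rewrite subr_eq0 => /eqP->; ring.
Qed.

End Basis.

(** * Two-cochains as bilinear maps *)

Section Cochains.
Variables (K : fieldType) (n m : nat).
Local Notation sl := (SL0 K n * SL1 K m)%type.
Local Notation cochain := (seq (SL0 K n) -> seq (SL1 K m) -> sl).
Local Notation coch := (@is_cochain K (SL K n m) (adjoint (SL K n m))).

(** The components of c on (even, even), (even, odd) and (odd, odd) arguments,
put together so that bilinear extension from the basis is done once.  The (odd,
even) component is left out: it repeats the (even, odd) one. *)
Definition pairing (c : cochain) (x y : sl) : sl :=
  c [:: x.1; y.1] [::] + c [:: x.1] [:: y.2] + c [::] [:: x.2; y.2].

Lemma pairing_linearr c x : coch 2 c -> linear (pairing c x).
Proof.
case=> lin0 lin1 _ _ _ a y z; rewrite /pairing /=.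
rewrite (lin0 [:: x.1] [::] [::] a y.1 z.1) (lin1 [:: x.1] [::] [::] a y.2 z.2).
rewrite (lin1 [::] [:: x.2] [::] a y.2 z.2).
by rewrite !scalerDr [RHS]addrACA; congr (_ + _); rewrite addrACA.
Qed.

Lemma pairing_linearl c y : coch 2 c -> linear ((pairing c)^~ y).
Proof.
case=> lin0 lin1 _ _ _ a x z; rewrite /pairing /=.
rewrite (lin0 [::] [:: y.1] [::] a x.1 z.1) (lin0 [::] [::] [:: y.2] a x.1 z.1).
rewrite (lin1 [::] [::] [:: y.2] a x.2 z.2).
by rewrite !scalerDr [RHS]addrACA; congr (_ + _); rewrite addrACA.
Qed.

Section Eval.
Variable (c : cochain).
Hypothesis cP : coch 2 c.

Lemma pairing_ee x y : pairing c (ev x) (ev y) = c [:: x; y] [::].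
Proof.
case: cP => lin0 lin1 _ _ _; rewrite /pairing /=.
rewrite (linear_at0 (lin1 [:: x] [::] [::])) addr0.
by rewrite (linear_at0 (lin1 [::] [::] [:: 0])) addr0.
Qed.

Lemma pairing_eo x h : pairing c (ev x) (od h) = c [:: x] [:: h].
Proof.
case: cP => lin0 lin1 _ _ _; rewrite /pairing /=.
rewrite (linear_at0 (lin0 [:: x] [::] [::])) add0r.
by rewrite (linear_at0 (lin1 [::] [::] [:: h])) addr0.
Qed.

Lemma pairing_oo g h : pairing c (od g) (od h) = c [::] [:: g; h].
Proof.
case: cP => lin0 lin1 _ _ _; rewrite /pairing /=.
rewrite (linear_at0 (lin0 [::] [:: 0] [::])) add0r.
by rewrite (linear_at0 (lin0 [::] [::] [:: h])) add0r.
Qed.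

End Eval.

End Cochains.

(** * Contraction of a cocycle with the torus *)

Section Toral.
Variables (K : fieldType) (n m : nat).
Local Notation sl := (SL0 K n * SL1 K m)%type.
Local Notation br := (@SL_br K n m).
Local Notation D := (@twisted_derivation K n m).
Local Notation cochain := (seq (SL0 K n) -> seq (SL1 K m) -> sl).
Local Notation coch := (@is_cochain K (SL K n m) (adjoint (SL K n m))).
Local Notation dif := (@differential K (SL K n m) (adjoint (SL K n m))).

Lemma basis_even (a : sl_index n m) :
  ~~ isodd a -> basis K a = ev (basis K a).1 :> sl.
Proof. by case: a => [[]|]. Qed.

Lemma basis_odd (a : sl_index n m) :
  isodd a -> basis K a = od (basis K a).2 :> sl.
Proof. by case: a. Qed.

Lemma homogeneous_ev (z : sl) : homogeneous false z -> z = ev z.1.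
Proof. by case: z => u v /= ->. Qed.

Lemma homogeneous_od (z : sl) : homogeneous true z -> z = od z.2.
Proof. by case: z => u v /= ->. Qed.

Lemma br_ev x y : br (ev x) (ev y) = ev (br (ev x) (ev y)).1.
Proof. exact/homogeneous_ev/(@SL_br_homogeneous K n m false false). Qed.

Lemma br_ev_od x h : br (ev x) (od h) = od (br (ev x) (od h)).2.
Proof. exact/homogeneous_od/(@SL_br_homogeneous K n m false true). Qed.

Lemma br_od g h : br (od g) (od h) = 0.
Proof. exact: SL_br_odd. Qed.

Lemma pairing_ee_skew (c : cochain) x y : coch 2 c ->
  c [:: x; y] [::] = - c [:: y; x] [::].
Proof.
case=> lin0 _ alt _ _.
have addl u v z := linear_atD u v (lin0 [::] [:: z] [::]).
have addr u v z := linear_atD u v (lin0 [:: z] [::] [::]).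
have := alt [::] [::] [::] (x + y) [::]; rewrite /= in addl addr *.
rewrite addl !addr (alt [::] [::] [::] x [::]) (alt [::] [::] [::] y [::]).
by rewrite add0r addr0 => /eqP; rewrite addr_eq0 => /eqP.
Qed.

(** The shape that the cocycle condition on (t, x, y) takes for each choice of
the parities of x and y. *)
Lemma weight_transpose (V : lmodType K) (a b s : K) (X F T A B : V) :
  a *: X + b *: X - F - T + A - s *: B = 0 ->
  (a + b) *: X = T + (F - A + s *: B).
Proof.
rewrite -scalerDl => /eqP; rewrite subr_eq0 => /eqP<-.
set Y := (a + b) *: X.
by rewrite [_ + A]addrC !addrA subrK -[RHS]addrA -opprD [F + T]addrC
  [T + F + Y]addrC addrK.
Qed.

Lemma toral_ee (c : cochain) t x y wx wy : coch 2 c -> dif c = 0 ->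
    br (ev t) (ev x) = wx *: ev x -> br (ev t) (ev y) = wy *: ev y ->
  (wx + wy) *: pairing c (ev x) (ev y) =
  br (ev t) (pairing c (ev x) (ev y)) + D 1 (pairing c (ev t)) (ev x) (ev y).
Proof.
move=> cP dc0 tx ty; rewrite /twisted_derivation br_ev !pairing_ee //.
have ex : (br (ev t) (ev x)).1 = wx *: x by rewrite tx.
have ey : (br (ev t) (ev y)).1 = wy *: y by rewrite ty.
have : c [:: wx *: x; y] [::] - c [:: wy *: y; x] [::]
    + c [:: (br (ev x) (ev y)).1; t] [::] - br (ev t) (c [:: x; y] [::])
    + br (ev x) (c [:: t; y] [::]) - br (ev y) (c [:: t; x] [::]) = 0.
  rewrite -ex -ey; apply: etrans (congr1 (fun f : cochain => f [:: t; x;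
    y] [::]) dc0).
  apply: esym; exact: (@differential_eee K (SL K n m) (adjoint (SL K n m)) c t
    x y).
have [lin0 _ _ _ _] := cP.
rewrite (linear_atZ _ _ (lin0 [::] [:: y] [::])).
rewrite (linear_atZ _ _ (lin0 [::] [:: x] [::])).
rewrite /= (pairing_ee_skew y x cP) (pairing_ee_skew (br _ _).1 t cP).
move=> E; apply: weight_transpose; rewrite scale1r -[RHS]E.
by rewrite scalerN opprK.
Qed.

Lemma toral_eo (c : cochain) t x h wx wh : coch 2 c -> dif c = 0 ->
    br (ev t) (ev x) = wx *: ev x -> br (ev t) (od h) = wh *: od h ->
  (wx + wh) *: pairing c (ev x) (od h) =
  br (ev t) (pairing c (ev x) (od h)) + D 1 (pairing c (ev t)) (ev x) (od h).
Proof.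
move=> cP dc0 tx th.
rewrite /twisted_derivation br_ev_od !pairing_ee // !pairing_eo //.
have ex : (br (ev t) (ev x)).1 = wx *: x by rewrite tx.
have eh : (br (ev t) (od h)).2 = wh *: h by rewrite th.
have : c [:: wx *: x] [:: h] + c [:: x] [:: wh *: h]
    - c [:: t] [:: (br (ev x) (od h)).2] - br (ev t) (c [:: x] [:: h])
    + br (ev x) (c [:: t] [:: h]) - br (od h) (c [:: t; x] [::]) = 0.
  rewrite -ex -eh; apply: etrans (congr1 (fun f : cochain => f [:: t;
    x] [:: h]) dc0).
  apply: esym; exact: (@differential_eeo K (SL K n m) (adjoint (SL K n m)) c t
    x h).
have [lin0 lin1 _ _ _] := cP.
rewrite (linear_atZ _ _ (lin0 [::] [::] [:: h])).
rewrite (linear_atZ _ _ (lin1 [:: x] [::] [::])).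
by move=> E; apply: weight_transpose; rewrite scale1r -[RHS]E.
Qed.

Lemma toral_oo (c : cochain) t g h wg wh : coch 2 c -> dif c = 0 ->
    br (ev t) (od g) = wg *: od g -> br (ev t) (od h) = wh *: od h ->
  (wg + wh) *: pairing c (od g) (od h) =
  br (ev t) (pairing c (od g) (od h)) + D (-1) (pairing c (ev t)) (od g) (od h).
Proof.
move=> cP dc0 tg th; rewrite /twisted_derivation br_od.
rewrite (linear_at0 (pairing_linearr _ cP)) !pairing_oo // !pairing_eo //.
have eg : (br (ev t) (od g)).2 = wg *: g by rewrite tg.
have eh : (br (ev t) (od h)).2 = wh *: h by rewrite th.
have : c [::] [:: wg *: g; h] + c [::] [:: wh *: h; g]
    + c [:: (br (od g) (od h)).1; t] [::] - br (ev t) (c [::] [:: g; h])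
    + br (od g) (c [:: t] [:: h]) + br (od h) (c [:: t] [:: g]) = 0.
  rewrite -eg -eh; apply: etrans (congr1 (fun f : cochain => f [:: t] [:: g;
    h]) dc0).
  apply: esym; exact: (@differential_eoo K (SL K n m) (adjoint (SL K n m)) c t
    g h).
rewrite br_od.
have [lin0 lin1 _ sym _] := cP.
rewrite (linear_at0 (lin0 [::] [:: t] [::])).
rewrite (linear_atZ _ _ (lin1 [::] [::] [:: h])).
rewrite (linear_atZ _ _ (lin1 [::] [::] [:: g])).
rewrite /= (sym [::] [:: h; g] [:: g; h]); last first.
  by rewrite (perm_catC [:: h] [:: g]).
move=> E; apply: weight_transpose.
by rewrite scaleN1r opprK subr0 -[RHS]E addr0.
Qed.

(** The cocycle condition on (t, a, b), where t acts on a and b by scalars.  The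
implication on parities excludes the (odd, even) arguments, on which [pairing]
carries no information. *)
Lemma toral_equation (c : cochain) t (a b k : sl_index n m) :
    coch 2 c -> dif c = 0 -> isodd a ==> isodd b ->
  (tweight t a + tweight t b - tweight t k)
    * sl_coef k (pairing c (basis K a) (basis K b)) =
  sl_coef k (D ((-1) ^+ (isodd a && isodd b)) (pairing c (ev (toral n t)))
             (basis K a) (basis K b)).
Proof.
move=> cP dc0 parP.
suff: (tweight t a + tweight t b) *: pairing c (basis K a) (basis K b) =
    br (ev (toral n t)) (pairing c (basis K a) (basis K b))
    + D ((-1) ^+ (isodd a && isodd b)) (pairing c (ev (toral n t)))
             (basis K a) (basis K b).
  move/(congr1 (sl_coef k)); rewrite sl_coefZ sl_coefD sl_coef_toral_br.
  by rewrite mulrBl => ->; rewrite addrC addKr.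
have ta := @toral_br_basis K n m t a; have tb := @toral_br_basis K n m t b.
case: (boolP (isodd a)) parP => oa /= ob.
  rewrite ob expr1.
  rewrite (basis_odd oa) (basis_odd ob) in ta tb *.
  exact: toral_oo.
case: (boolP (isodd b)) => {}ob; rewrite expr0.
  rewrite (basis_even oa) (basis_odd ob) in ta tb *.
  exact: toral_eo.
rewrite (basis_even oa) (basis_even ob) in ta tb *.
exact: toral_ee.
Qed.

End Toral.

(** * Brackets of basis vectors *)

Section Brackets.
Variables (K : fieldType) (n m : nat).
Local Notation sl := (SL0 K n * SL1 K m)%type.
Local Notation br := (@SL_br K n m).
Local Notation D := (@twisted_derivation K n m).
Local Notation X := (SLX K n m).
Local Notation T := (SLT K n m).
Local Notation Y := (SLY K n m).
Implicit Types (z : sl) (l : nat).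

Definition coord_basisE := (coordXX, @coordXT K n m, coordXY, coordTX,
  @coordTT K n m, coordTY, coordYX, @coordYT K n m, coordYY).

Lemma coordX_brX1 z l : (1 < l < n)%N -> coordX l.+1 (br (X 1) z) = coordX l z.
Proof.
move=> lP; rewrite coordX_br ?coord_basisE /=; last by lia.
have -> : (2 < l.+1)%N = true by lia.
have -> : (0 < n)%N = true by lia.
have -> : (1 == l)%N = false by lia.
have -> : (1 == l.+1)%N = false by lia.
by rewrite /=; ring.
Qed.

Lemma coordX_brX_next z l :
  (1 < l < n)%N -> coordX l.+1 (br (X l) z) = - coordX 1 z.
Proof.
move=> lP; rewrite coordX_br ?coord_basisE /=; last by lia.
have -> : (2 < l.+1)%N = true by lia.
have -> : (l == 1)%N = false by lia.
have -> : (l == l.+1)%N = false by lia.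
have -> : (0 < l <= n)%N = true by lia.
by rewrite eqxx /=; ring.
Qed.

Lemma coordX_brX_same z l : (0 < l <= n)%N ->
  coordX l (br (X l) z) = - (l%:R * coordT 1 z + (1 < l)%:R * coordT 2 z).
Proof.
move=> lP; rewrite coordX_br ?coord_basisE //= lP eqxx.
have -> : (l == l.-1)%N = false by lia.
have [l_gt2|_] := boolP (2 < l)%N; last by rewrite /=; ring.
have -> : (l == 1)%N = false by lia.
by rewrite /=; ring.
Qed.

Lemma coordY_brX1 z l : (0 < n)%N -> (0 < l < m)%N ->
  coordY l.+1 (br (X 1) z) = coordY l z.
Proof.
move=> n_gt0 lP; rewrite coordY_br ?coord_basisE /=; last by lia.
rewrite n_gt0; have -> : (1 < l.+1)%N = true by lia.
by rewrite /=; ring.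
Qed.

Lemma coordY_brY_next z l :
  (0 < l < m)%N -> coordY l.+1 (br (Y l) z) = - coordX 1 z.
Proof.
move=> lP; rewrite coordY_br ?coord_basisE /=; last by lia.
have -> : (1 < l.+1)%N = true by lia.
have -> : (l == l.+1)%N = false by lia.
have -> : (0 < l <= m)%N = true by lia.
by rewrite eqxx /=; ring.
Qed.

Lemma coordY_brY_same z l : (0 < l <= m)%N ->
  coordY l (br (Y l) z) = - (l%:R * coordT 1 z + coordT 3 z).
Proof.
move=> lP; rewrite coordY_br ?coord_basisE //= lP eqxx.
have -> : (l == l.-1)%N = false by lia.
by rewrite /=; ring.
Qed.

Lemma br_X1_X l : (1 < l < n)%N -> br (X 1) (X l) = X l.+1.
Proof.
move=> lP; apply: coord_inj => [k kP|k|k kP].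
- rewrite coordX_br // !coord_basisE.
  have -> : (l == 1)%N = false by lia.
  have -> : (0 < n)%N = true by lia.
  have -> : (l.+1 == k) && (0 < k <= n)%N =
    (2 < k)%N && ((l == k.-1) && (0 < k.-1 <= n)%N).
    by lia.
  by case: (2 < k)%N; rewrite /=; ring.
- by rewrite coordT_br coord_basisE.
- by rewrite coordY_br // !coord_basisE; ring.
Qed.

Lemma br_X1_Y l : (0 < n)%N -> (0 < l < m)%N -> br (X 1) (Y l) = Y l.+1.
Proof.
move=> n_gt0 lP; apply: coord_inj => [k kP|k|k kP].
- by rewrite coordX_br // !coord_basisE; ring.
- by rewrite coordT_br coord_basisE.
- rewrite coordY_br // !coord_basisE n_gt0.
  have -> : (l.+1 == k) && (0 < k <= m)%N =
    (1 < k)%N && ((l == k.-1) && (0 < k.-1 <= m)%N).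
    by lia.
  by case: (1 < k)%N; rewrite /=; ring.
Qed.

Lemma coord_twisted_derivation (g : sl -> K^o) s (f : sl -> sl) x y :
  linear g ->
  g (D s f x y) = g (f (br x y)) - g (br x (f y)) + s * g (br y (f x)).
Proof.
move=> lin; rewrite /twisted_derivation.
move: (f (br x y)) (br x (f y)) (br y (f x)) => A B C.
by rewrite -scaleN1r !(linear_atD _ _ lin) !(linear_atZ _ _ lin) scaleN1r.
Qed.

Lemma coordT_D k s (f : sl -> sl) x y :
  coordT k (D s f x y) = coordT k (f (br x y)).
Proof.
rewrite coord_twisted_derivation; last exact: coordT_linear.
by rewrite (coordT_br k x) (coordT_br k y) mulr0 subr0 addr0.
Qed.

Lemma coordX_D_X1_X (f : sl -> sl) l : (1 < l < n)%N ->
  coordX l.+1 (D 1 f (X 1) (X l)) =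
  coordX l.+1 (f (X l.+1)) - coordX l (f (X l)) - coordX 1 (f (X 1)).
Proof.
move=> lP; rewrite coord_twisted_derivation; last exact: coordX_linear.
by rewrite mul1r br_X1_X // coordX_brX1 // coordX_brX_next.
Qed.

Lemma coordY_D_X1_Y (f : sl -> sl) l : (0 < n)%N -> (0 < l < m)%N ->
  coordY l.+1 (D 1 f (X 1) (Y l)) =
  coordY l.+1 (f (Y l.+1)) - coordY l (f (Y l)) - coordX 1 (f (X 1)).
Proof.
move=> n_gt0 lP; rewrite coord_twisted_derivation; last exact: coordY_linear.
by rewrite mul1r br_X1_Y // coordY_brX1 // coordY_brY_next.
Qed.

Lemma linear_comb3 (V : lmodType K) (a s : K) (A A' B B' C C' : V) :
  a *: A + A' - (a *: B + B') + s *: (a *: C + C') =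
  a *: (A - B + s *: C) + (A' - B' + s *: C').
Proof.
rewrite opprD (addrACA (a *: A)) !scalerDr scalerN !scalerA [s * a]mulrC.
by rewrite (addrACA (a *: A - _)).
Qed.

Lemma D_linearr s (f : sl -> sl) x : linear f -> linear (D s f x).
Proof.
move=> lin a y z; rewrite /twisted_derivation -linear_comb3;
  congr (_ - _ + _ *: _).
- by rewrite -lin; congr f; apply: SL_br_linearr.
- by rewrite lin; apply: SL_br_linearr.
- exact: SL_br_linearl.
Qed.

Lemma D_linearl s (f : sl -> sl) y : linear f -> linear (D s f ^~ y).
Proof.
move=> lin a x z; rewrite /twisted_derivation -linear_comb3;
  congr (_ - _ + _ *: _).
- by rewrite -lin; congr f; apply: SL_br_linearl.
- exact: SL_br_linearl.
- by rewrite lin; apply: SL_br_linearr.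
Qed.

Lemma D_skew (f : sl -> sl) x y : linear f -> D 1 f x y = - D 1 f y x.
Proof.
move=> lin; rewrite /twisted_derivation.
have -> : f (br x y) = - f (br y x).
  by rewrite SL_brC -scaleN1r (linear_atZ _ _ lin) scaleN1r.
move: (f (br y x)) (br x (f y)) (br y (f x)) => A B C.
by rewrite !scale1r !opprD opprK addrAC.
Qed.

(** On a weight vector the first two terms of the differential both multiply by
the weight, and cancel in the coordinate along that vector. *)
Lemma sl_coef_D_toral s (f : sl -> sl) t k : linear f ->
  sl_coef k (D s f (ev (toral n t)) (basis K k)) =
  s * sl_coef k (br (basis K k) (f (ev (toral n t)))).
Proof.
move=> lin; rewrite /twisted_derivation toral_br_basis (linear_atZ _ _ lin).
move: (br (basis K k) _) => C.
by rewrite sl_coefD sl_coefZ -scaleN1r sl_coefD !sl_coefZ sl_coef_toral_br;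
  ring.
Qed.

End Brackets.

(** * A primitive of a two-cocycle *)

Lemma ord_succ d k : (0 < k <= d)%N -> exists i : 'I_d, i.+1 = k.
Proof. by case: k => // k lt_kd; exists (Ordinal lt_kd). Qed.

Section Primitive.
Variables (K : fieldType) (n m : nat).
Hypotheses (char0 : [pchar K] =i pred0) (n_ge2 : (2 <= n)%N)
  (m_ge1 : (1 <= m)%N).
Local Notation sl := (SL0 K n * SL1 K m)%type.
Local Notation br := (@SL_br K n m).
Local Notation D := (@twisted_derivation K n m).
Local Notation X := (SLX K n m).
Local Notation T := (SLT K n m).
Local Notation Y := (SLY K n m).
Local Notation cochain := (seq (SL0 K n) -> seq (SL1 K m) -> sl).
Local Notation coch := (@is_cochain K (SL K n m) (adjoint (SL K n m))).
Local Notation dif := (@differential K (SL K n m) (adjoint (SL K n m))).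

(** T_1 + (n + m) T_2 + 4 (n + m) T_3.  The multipliers are large enough for
X_1, the other X_i and the Y_j to occupy separate ranges of weights, and for the
sum of two weights from the last two ranges never to be a weight again. *)
Definition regular : 'rV[K]_3 :=
  unit_row K 3 1 + (n + m)%:R *: unit_row K 3 2
  + (4 * (n + m))%:R *: unit_row K 3 3.

Definition degree (a : sl_index n m) : nat :=
  match a with
  | inl (inl i) => i.+1 + (0 < i) * (n + m)
  | inl (inr _) => 0
  | inr j => j.+1 + 4 * (n + m)
  end.

Lemma tweight_regular a : tweight regular a = (degree a)%:R.
Proof.
have regE k : coordr k regular = (k == 1)%:R + (n + m)%:R * (k == 2)%:R
    + (4 * (n + m))%:R * (k == 3)%:R.
  have cD (u v : 'rV[K]_3) : coordr k (u + v) = coordr k u + coordr k v.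
    exact: (linear_atD u v (@coordr_linear K 3 k)).
  have cZ c (u : 'rV[K]_3) : coordr k (c *: u) = c * coordr k u.
    exact: (linear_atZ c u (@coordr_linear K 3 k)).
  rewrite /regular !cD !cZ !coordr_unit.
  by case: k {cD cZ} => [|[|[|[|k]]]] /=; ring.
by case: a => [[i|//]|j] /=; rewrite !regE /= natrD natrM; ring.
Qed.

Variables (c : cochain).
Hypotheses (cP : coch 2 c) (dc0 : dif c = 0).
Let F := pairing c.

(** The eigenvalues u_l and v_l on X_l and Y_l of the diagonal part of the
primitive: u_(l+1) - u_l - u_1 and v_(l+1) - v_l - u_1 have to be the
coefficients of c(X_1, X_l) and c(X_1, Y_l), and u_1 = u_2 = v_1 = 0 is a
legitimate normalization as the diagonal derivations are inner. *)
Definition Xscale l := \sum_(2 <= i < l) coordX i.+1 (F (X 1) (X i)).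
Definition Yscale l := \sum_(1 <= j < l) coordY j.+1 (F (X 1) (Y j)).

(** The coordinates of the torus element s_i that brackets X_1, X_2 and Y_1 as
c(T_i, _) does, in the coordinates along them; the weights of these three
vectors are T_1^*, 2 T_1^* + T_2^* and T_1^* + T_3^*. *)
Definition Tshift i k :=
  let s := coordX 1 (F (T i) (X 1)) in
  match k with
  | 1 => s
  | 2 => coordX 2 (F (T i) (X 2)) - 2%:R * s
  | _ => coordY 1 (F (T i) (Y 1)) - s
  end.

(** Between distinct weights this is the contraction homotopy.  Equality of
weights forces equal indices for two X or two Y, so the other branch is the
diagonal map together with T_i -> - s_i. *)
Definition primitive_entry (a k : sl_index n m) : K :=
  if tweight regular a != tweight regular k then
    (tweight regular a - tweight regular k)^-1
      * sl_coef k (F (ev (toral n regular)) (basis K a))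
  else match a, k with
  | inl (inl i), inl (inl _) => Xscale i.+1
  | inl (inr i), inl (inr k) => - Tshift i.+1 k.+1
  | inr j, inr _ => Yscale j.+1
  | _, _ => 0
  end.

Definition primitive : sl -> sl := of_matrix primitive_entry.

Lemma primitive_linear : linear primitive.
Proof. exact: of_matrix_linear. Qed.

Lemma primitive_X l : (0 < l <= n)%N -> coordX l (primitive (X l)) = Xscale l.
Proof.
case: l => // l lt_ln; pose a : sl_index n m := inl (inl (Ordinal lt_ln)).
by apply: etrans (sl_coef_of_matrix primitive_entry a a) _;
  rewrite /primitive_entry eqxx.
Qed.

Lemma primitive_Y l : (0 < l <= m)%N -> coordY l (primitive (Y l)) = Yscale l.
Proof.
case: l => // l lt_lm; pose a : sl_index n m := inr (Ordinal lt_lm).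
by apply: etrans (sl_coef_of_matrix primitive_entry a a) _;
  rewrite /primitive_entry eqxx.
Qed.

Lemma primitive_T i k : (0 < i <= 3)%N -> (0 < k <= 3)%N ->
  coordT k (primitive (T i)) = - Tshift i k.
Proof.
case: i k => // i [] // k lt_i lt_k.
pose a : sl_index n m := inl (inr (Ordinal lt_i)).
pose b : sl_index n m := inl (inr (Ordinal lt_k)).
by apply: etrans (sl_coef_of_matrix primitive_entry a b) _;
  rewrite /primitive_entry eqxx.
Qed.

Let Flinr x : linear (F x). Proof. exact: pairing_linearr. Qed.

(** On balanced components the homotopy formula makes c(t, _) a derivation, for
every torus element t. *)
Lemma toral_balanced t (a b k : sl_index n m) : isodd a ==> isodd b ->
    tweight t a + tweight t b = tweight t k ->
  sl_coef k (D ((-1) ^+ (isodd a && isodd b)) (F (ev (toral n t)))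
             (basis K a) (basis K b)) = 0.
Proof. by move=> ab e; rewrite -toral_equation // e subrr mul0r. Qed.

Lemma toral_cocycle_X_step i l : (1 < l < n)%N ->
  coordX l.+1 (F (T i) (X l.+1)) =
  coordX l (F (T i) (X l)) + coordX 1 (F (T i) (X 1)).
Proof.
move=> lP; have lt0 : (0 < n)%N by lia.
have lt1 : (l.-1 < n)%N by lia.
have lt2 : (l < n)%N by lia.
have e1 : (0 < l.-1)%N = true by lia.
have e2 : (0 < l)%N = true by lia.
have lm1 : l.-1.+1 = l by lia.
pose t := unit_row K 3 i.
have wt : tweight t (inl (inl (Ordinal lt0)) : sl_index n m)
    + tweight t (inl (inl (Ordinal lt1)) : sl_index n m)
    = tweight t (inl (inl (Ordinal lt2)) : sl_index n m).
  rewrite /= e1 e2 lm1; move: (coordr 1 t) (coordr 2 t) => t1 t2.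
  by rewrite -natr1; ring.
have /(_ isT) := fun ab => toral_balanced ab wt.
rewrite /= lm1 expr0 coordX_D_X1_X // => /eqP.
by rewrite -addrA -opprD subr_eq0 => /eqP.
Qed.

Lemma toral_cocycle_Y_step i l : (0 < l < m)%N ->
  coordY l.+1 (F (T i) (Y l.+1)) =
  coordY l (F (T i) (Y l)) + coordX 1 (F (T i) (X 1)).
Proof.
move=> lP; have lt0 : (0 < n)%N by lia.
have lt1 : (l.-1 < m)%N by lia.
have lt2 : (l < m)%N by lia.
have lm1 : l.-1.+1 = l by lia.
pose t := unit_row K 3 i.
have wt : tweight t (inl (inl (Ordinal lt0)) : sl_index n m)
    + tweight t (inr (Ordinal lt1) : sl_index n m)
    = tweight t (inr (Ordinal lt2) : sl_index n m).
  rewrite /= lm1; move: (coordr 1 t) (coordr 3 t) => t1 t3.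
  by rewrite -natr1; ring.
have /(_ isT) := fun ab => toral_balanced ab wt.
rewrite /= lm1 expr0 coordY_D_X1_Y // => /eqP.
by rewrite -addrA -opprD subr_eq0 => /eqP.
Qed.

(** A diagonal derivation is determined by its eigenvalues on X_1 and X_2, since
X_1 and X_2 generate the X_l. *)
Lemma toral_cocycle_X i l : (0 < l <= n)%N ->
  coordX l (F (T i) (X l)) = l%:R * Tshift i 1 + (1 < l)%:R * Tshift i 2.
Proof.
elim: l => // l IHl lP.
have [->|l_gt0] := posnP l; first by rewrite mul1r mul0r addr0.
have [->|l_neq1] := eqVneq l 1%N; first by rewrite mul1r addrC subrK.
have e1 : (1 < l)%N = true by lia.
rewrite toral_cocycle_X_step; last by lia.
rewrite IHl; last by lia.
rewrite -[coordX 1 _]/(Tshift i 1) -natr1 ltnS l_gt0 e1.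
by move: (Tshift i 1) (Tshift i 2) => s1 s2; ring.
Qed.

Lemma toral_cocycle_Y i l : (0 < l <= m)%N ->
  coordY l (F (T i) (Y l)) = l%:R * Tshift i 1 + Tshift i 3.
Proof.
elim: l => // l IHl lP.
have [->|l_gt0] := posnP l; first by rewrite mul1r addrC subrK.
rewrite toral_cocycle_Y_step; last by lia.
rewrite IHl; last by lia.
rewrite -[coordX 1 _]/(Tshift i 1) -natr1.
by move: (Tshift i 1) (Tshift i 3) => s1 s3; ring.
Qed.

(** The element c(T_i, T_j) brackets X_1, X_2 and Y_1 to vectors without
component along them, and no nonzero torus element does. *)
Lemma toral_cocycle_T i j k : (0 < i <= 3)%N -> (0 < j <= 3)%N ->
  (0 < k <= 3)%N -> coordT k (F (T i) (T j)) = 0.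
Proof.
move=> iP jP kP; have [j' def_j] : exists j' : 'I_3, j'.+1 =
  j by apply: ord_succ.
(* The homotopy formula for t = T_i on the pair (T_j, a), along a itself: the
   terms in c(T_i, a) cancel. *)
have diag (a : sl_index n m) :
    sl_coef a (br (basis K a) (F (T i) (T j))) = 0.
  have ab : isodd (inl (inr j') : sl_index n m) ==> isodd a by apply/implyP.
  have := toral_balanced ab (add0r (tweight (unit_row K 3 i) a)).
  rewrite /= expr0 def_j.
  have -> : T j = ev (toral n (unit_row K 3 j)) by [].
  by rewrite sl_coef_D_toral ?mul1r.
have n_gt0 : (0 < n)%N by lia.
have := diag (inl (inl (Ordinal n_gt0))).
have := diag (inl (inl (Ordinal n_ge2))).
have := diag (inr (Ordinal m_ge1)).
rewrite /= !coordX_brX_same ?coordY_brY_same //; try lia.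
move=> /eqP; rewrite oppr_eq0 => /eqP eY.
move=> /eqP; rewrite oppr_eq0 => /eqP eX2.
move=> /eqP; rewrite oppr_eq0 mul0r addr0 mul1r => /eqP eX1.
move: eY eX2; rewrite eX1 !mulr0 !add0r mul1r => eY eX2.
by case: k kP => [|[|[|[|k]]]].
Qed.

Lemma primitive_TX i l : (0 < i <= 3)%N -> (0 < l <= n)%N ->
  coordX l (F (T i) (X l)) = coordX l (D 1 primitive (T i) (X l)).
Proof.
move=> iP lP; have [k def_l] : exists k : 'I_n, k.+1 = l by apply: ord_succ.
have := sl_coef_D_toral 1 (unit_row K 3 i) (inl (inl k)) primitive_linear.
rewrite toral_cocycle_X // /= def_l => ->.
by rewrite mul1r coordX_brX_same // !primitive_T // !mulrN opprD !opprK.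
Qed.

Lemma primitive_TY i l : (0 < i <= 3)%N -> (0 < l <= m)%N ->
  coordY l (F (T i) (Y l)) = coordY l (D 1 primitive (T i) (Y l)).
Proof.
move=> iP lP; have [k def_l] : exists k : 'I_m, k.+1 = l by apply: ord_succ.
have := sl_coef_D_toral 1 (unit_row K 3 i) (inr k) primitive_linear.
rewrite toral_cocycle_Y // /= def_l => ->.
by rewrite mul1r coordY_brY_same // !primitive_T // mulrN opprD !opprK.
Qed.

Lemma primitive_TT i j k : (0 < i <= 3)%N -> (0 < j <= 3)%N ->
  (0 < k <= 3)%N ->
  coordT k (F (T i) (T j)) = coordT k (D 1 primitive (T i) (T j)).
Proof.
move=> iP jP kP; rewrite toral_cocycle_T //.
have [j' def_j] : exists j' : 'I_3, j'.+1 = j by apply: ord_succ.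
rewrite coordT_D; have -> : br (T i) (T j) = 0.
  rewrite -def_j; apply: etrans (toral_br_basis _ (inl (inr j'))) _.
  exact: scale0r.
by rewrite (linear_at0 primitive_linear) (linear_at0 (@coordT_linear K n m k)).
Qed.

Lemma primitive_X1X l : (1 < l < n)%N ->
  coordX l.+1 (F (X 1) (X l)) = coordX l.+1 (D 1 primitive (X 1) (X l)).
Proof.
move=> lP; rewrite coordX_D_X1_X // !primitive_X; try lia.
rewrite /Xscale [\sum_(2 <= i < 1) _]big_geq // big_nat_recr /=; last by lia.
by rewrite subr0 [RHS]addrC addKr.
Qed.

Lemma primitive_X1Y l : (0 < l < m)%N ->
  coordY l.+1 (F (X 1) (Y l)) = coordY l.+1 (D 1 primitive (X 1) (Y l)).
Proof.
move=> lP; rewrite coordY_D_X1_Y ?primitive_X ?primitive_Y; try lia.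
rewrite /Xscale [\sum_(2 <= i < 1) _]big_geq //.
rewrite /Yscale big_nat_recr /=; last by lia.
by rewrite subr0 [RHS]addrC addKr.
Qed.

Lemma pairing_basis_skew (a b : sl_index n m) : ~~ isodd a -> ~~ isodd b ->
  F (basis K a) (basis K b) = - F (basis K b) (basis K a).
Proof.
move=> a0 b0; rewrite (basis_even K a0) (basis_even K b0) /F !pairing_ee //.
exact: pairing_ee_skew.
Qed.

(** The size of the multipliers in [regular] reduces the equation between
weights to five configurations, up to exchanging two even arguments. *)
Lemma degree_balanced (a b k : sl_index n m) : isodd a ==> isodd b ->
    (degree a + degree b)%N = degree k ->
  sl_coef k (F (basis K a) (basis K b)) =
  sl_coef k (D ((-1) ^+ (isodd a && isodd b)) primitive
               (basis K a) (basis K b)).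
Proof.
have skew (a' b' k' : sl_index n m) : ~~ isodd a' -> ~~ isodd b' ->
    sl_coef k' (F (basis K a') (basis K b')) =
      sl_coef k' (D 1 primitive (basis K a') (basis K b')) ->
    sl_coef k' (F (basis K b') (basis K a')) =
      sl_coef k' (D 1 primitive (basis K b') (basis K a')).
  move=> a'0 b'0 e; rewrite (pairing_basis_skew b'0 a'0).
  rewrite [in RHS](D_skew _ _ primitive_linear).
  by rewrite [LHS]sl_coefN [RHS]sl_coefN e.
case: a => [[i|i]|i]; case: b => [[j|j]|j]; case: k => [[k|k]|k] //= _;
  have := ltn_ord i; have := ltn_ord j; have := ltn_ord k; try (by lia);
  move=> lt_k lt_j lt_i dP.
- have [j0|j_gt0] := posnP j.
    apply: (skew (inl (inl j)) (inl (inl i)) (inl (inl k))) => //=.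
    have -> : k.+1 = i.+2 by lia.
    by rewrite j0; apply: primitive_X1X; lia.
  have [-> ->] : k.+1 = j.+2 /\ i = 0 :> nat by lia.
  by apply: primitive_X1X; lia.
- apply: (skew (inl (inr j)) (inl (inl i)) (inl (inl k))) => //=.
  have -> : k = i :> nat by lia.
  by apply: primitive_TX; lia.
- have [-> ->] : k.+1 = j.+2 /\ i = 0 :> nat by lia.
  by apply: primitive_X1Y; lia.
- have -> : k = j :> nat by lia.
  by apply: primitive_TX; lia.
- by apply: primitive_TT; lia.
- have -> : k = j :> nat by lia.
  by apply: primitive_TY; lia.
Qed.

(** The unbalanced components agree by the contraction homotopy, the balanced
ones by the choice of the diagonal and torus parts. *)
Lemma pairing_primitive (a b : sl_index n m) : isodd a ==> isodd b ->
  F (basis K a) (basis K b) =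
  D ((-1) ^+ (isodd a && isodd b)) primitive (basis K a) (basis K b).
Proof.
move=> ab; apply: sl_coef_ext => k.
have [w_eq|w_neq] := eqVneq (tweight regular a + tweight regular b)
                            (tweight regular k).
  apply: degree_balanced => //; apply/eqP; rewrite -(pchar0_natr_eq _ _ char0).
  by rewrite natrD -!tweight_regular w_eq.
rewrite (contract_D _ (Flinr (ev (toral n regular))) w_neq) => [|i l il_neq].
  rewrite -toral_equation // mulKf // subr_eq0 //.
by rewrite /primitive_entry il_neq.
Qed.

Section Parity.
Variable p : bool.
Hypothesis c_parity : @cochain_parity K (SL K n m) (adjoint (SL K n m)) p c.

(** Entries between equal weights join vectors of equal parity; for p odd they
vanish because they are built from coordinates of c of the wrong parity. *)
Lemma primitive_entry_parity (a k : sl_index n m) :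
  isodd k != isodd a (+) p -> primitive_entry a k = 0.
Proof.
move=> k_neq; rewrite /primitive_entry; case: ifP => [_|w_eq].
  have -> : sl_coef k (F (ev (toral n regular)) (basis K a)) = 0;
    last exact: mulr0.
  suff: homogeneous (isodd a (+) p) (F (ev (toral n regular)) (basis K a)).
    by move/homogeneous_sl_coefP; apply.
  case: (boolP (isodd a)) => oa.
    rewrite (basis_odd K oa) /F pairing_eo //.
    exact: (c_parity [:: toral n regular] [:: (basis K a).2]).
  rewrite (basis_even K oa) /F pairing_ee //.
  exact: (c_parity [:: toral n regular; (basis K a).1] [::]).
have cX x y l : p -> coordX l (F (ev x) (ev y)) = 0.
  move=> p1; have := c_parity [:: x; y] [::];
    rewrite p1 => /SL_homogeneousP[cX _].
  by rewrite /F pairing_ee.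
have cY x y l : p -> coordY l (F (ev x) (od y)) = 0.
  move=> p1; have := c_parity [:: x] [:: y]; rewrite p1 => /SL_homogeneousP cY.
  by rewrite /F pairing_eo.
case: a k k_neq w_eq => [[i|i]|i] [[k|k]|k] //= k_neq _.
- rewrite /Xscale big1 // => l _; apply: cX; by case: (p) k_neq.
- have p1 : p by case: (p) k_neq.
  apply/eqP; rewrite oppr_eq0; apply/eqP; rewrite /Tshift.
  have e1 : coordX 1 (F (T i.+1) (X 1)) = 0 by apply: cX.
  have e2 : coordX 2 (F (T i.+1) (X 2)) = 0 by apply: cX.
  have e3 : coordY 1 (F (T i.+1) (Y 1)) = 0 by apply: cY.
  by rewrite e1 e2 e3; case: (val k) => [|[|k']] /=; ring.
- rewrite /Yscale big1 // => l _; apply: cY; by case: (p) k_neq.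
Qed.

Lemma primitive_parity r x :
  homogeneous r x -> homogeneous (r (+) p) (primitive x).
Proof.
move=> /homogeneous_sl_coefP x0; apply/homogeneous_sl_coefP => k kP.
rewrite sl_coef_sum big1 // => a _.
have [ar|/x0->] := eqVneq (isodd a) r; last exact: mul0r.
by rewrite primitive_entry_parity ?mulr0 // ar.
Qed.

End Parity.

End Primitive.

(** * Vanishing of the second cohomology *)

Section Vanishing.
Variables (K : fieldType) (n m : nat).
Hypotheses (char0 : [pchar K] =i pred0) (n_ge2 : (2 <= n)%N)
  (m_ge1 : (1 <= m)%N).
Local Notation sl := (SL0 K n * SL1 K m)%type.
Local Notation br := (@SL_br K n m).
Local Notation D := (@twisted_derivation K n m).
Local Notation cochain := (seq (SL0 K n) -> seq (SL1 K m) -> sl).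
Local Notation A := (adjoint (SL K n m)).

Definition cochain1 (f : sl -> sl) : cochain := fun gs hs =>
  match gs, hs with
  | [:: x], [::] => f (ev x)
  | [::], [:: y] => f (od y)
  | _, _ => 0
  end.

Lemma cochain1P f : linear f -> @is_cochain K (SL K n m) A 1 (cochain1 f).
Proof.
move=> lin.
have lin0 (U : lmodType K) : linear (fun _ : U => 0 : sl).
  by move=> a x y; rewrite scaler0 addr0.
have linl : linear (fun x : SL0 K n => f (ev x)).
  move=> a x y; rewrite -lin; congr f.
  by rewrite /ev; congr (_, _); rewrite /= scaler0 addr0.
have linr : linear (fun y : SL1 K m => f (od y)).
  move=> a x y; rewrite -lin; congr f.
  by rewrite /od; congr (_, _); rewrite /= scaler0 addr0.
split.
- by case=> [|g [|g' gs]] [|g1 gs'] [|h hs].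
- by case=> [|g [|g' gs]] [|h [|h' hs]] [|h1 hs'].
- by case=> [|g [|g' gs]] [|g1 gs'].
- move=> gs hs hs' /[dup] /perm_size sz /perm_small_eq eq_hs.
  have [le1|gt1] := leqP (size hs') 1%N; first by rewrite eq_hs.
  by case: hs hs' sz gt1 {eq_hs} => [|h [|h1 hs]] [|h' [|h1' hs']] //; case: gs.
- by case=> [|g [|g' gs]] [|h [|h' hs]] //= [].
Qed.

Lemma cochain1_parity p f :
    (forall r x, homogeneous r x -> homogeneous (r (+) p) (f x)) ->
  @cochain_parity K (SL K n m) A p (cochain1 f).
Proof.
have hom0 r : homogeneous r (0 : sl) by case: r.
move=> fP; case=> [|g [|g' gs]] [|h [|h' hs]] /=; try exact: hom0.
  exact: (fP true).
exact: (fP false).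
Qed.

(** Both c and the differential of its primitive come from bilinear maps, so the
comparison on basis vectors suffices in each of the three bidegrees. *)
Lemma two_cocycle_exact p c :
  @cocycle K (SL K n m) A 2 p c -> @coboundary K (SL K n m) A 2 p c.
Proof.
case=> cP c_par dc0; pose f := primitive c.
have f_lin : linear f := primitive_linear c.
exists (cochain1 f); split; first exact: cochain1P.
  exact/cochain1_parity/(primitive_parity cP c_par).
have ext s x y :
    (forall a b : sl_index n m, sl_coef a x != 0 -> sl_coef b y != 0 ->
       isodd a ==> isodd b /\ (-1) ^+ (isodd a && isodd b) = s) ->
  pairing c x y = D s f x y.
  move=> xy; apply: bilinear_ext => [u|u|u|u|a b a0 b0].
  - exact: pairing_linearr.
  - exact: pairing_linearl.
  - exact: D_linearr.
  - exact: D_linearl.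
  - by have [ab <-] := xy _ _ a0 b0; apply: pairing_primitive.
have evP (x : SL0 K n) (a : sl_index n m) : sl_coef a (ev x) != 0 ->
  isodd a = false.
  by case: (boolP (isodd a)) => // oa; rewrite sl_coef_ev_odd ?eqxx.
have odP (y : SL1 K m) (a : sl_index n m) : sl_coef a (od y) != 0 -> isodd a.
  by case: (boolP (isodd a)) => // oa; rewrite sl_coef_od_even ?eqxx.
have [_ _ _ _ c_deg] := cP.
apply: funext => gs; apply: funext => hs.
have [szP|szPn] := eqVneq (size gs + size hs)%N 2; last first.
  rewrite c_deg; last exact/eqP.
  have [_ _ _ _ f_deg] := cochain1P f_lin.
  by rewrite (differential_off_degree f_deg) //; apply/eqP.
case: gs hs szP => [|x [|y [|z gs]]] [|g [|h [|k hs]]] //= _.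
- apply: etrans (esym (pairing_oo cP g h)) _.
  rewrite (ext (-1)) => [|a b /odP-> /odP->//].
  apply: esym; apply: etrans (@differential_oo K (SL K n m) A _ g h) _.
  rewrite /twisted_derivation br_od (linear_at0 f_lin) sub0r scaleN1r.
  have -> : lbr11 g h = 0 :> lie0 (SL K n m).
    have e : (br (od g) (od h)).1 = 0 by rewrite br_od. exact: e.
  have -> : cochain1 f [:: 0] [::] = 0 by apply: linear_at0 f_lin.
  by rewrite sub0r.
- apply: etrans (esym (pairing_eo cP x g)) _.
  rewrite (ext 1) => [|a b /evP-> /odP->//].
  apply: esym; apply: etrans (@differential_eo K (SL K n m) A _ x g) _.
  by rewrite /twisted_derivation br_ev_od scale1r.
- apply: etrans (esym (pairing_ee cP x y)) _.
  rewrite (ext 1) => [|a b /evP-> /evP->//].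
  apply: esym; apply: etrans (@differential_ee K (SL K n m) A _ x y) _.
  by rewrite /twisted_derivation br_ev scale1r.
Qed.

Lemma cohomology_dim0 (L : lieSuperalgebra K) (M : lieSupermodule L) q p :
  (forall c, @cocycle K L M q p c -> @coboundary K L M q p c) ->
  cohomology_dim M q p 0.
Proof.
move=> exact_c; exists (fun _ => 0); split=> [[]//|c cP].
exists 0; split=> [|a _]; last by apply/rowP => -[].
by rewrite big_ord0 subr0; apply: exact_c.
Qed.

End Vanishing.

Theorem theorem4p1 (K : fieldType) (n m : nat)
    (charK : [pchar K] =i pred0) (n_ge2 : (2 <= n)%N) (m_ge1 : (1 <= m)%N) :
  exists d0 d1 : nat,
    [/\ cohomology_dim (adjoint (SL K n m)) 2 false d0,
        cohomology_dim (adjoint (SL K n m)) 2 true d1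
      & (d0 + d1)%N = 0%N].
Proof.
exists 0%N, 0%N; split=> //; apply: cohomology_dim0 => c;
  exact: two_cocycle_exact.
Qed.
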